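(* Let $\epsilon$ be a primitive cube root of unity and let $F=\mathbb{Q}(\epsilon)$ be the third cyclotomic field. Let $\alpha$ be a nonzero cubefree rational integer not equal to one, and let $K=F(\sqrt[3]{\alpha})$ be the corresponding Kummer field. Let $p$ and $q$ be distinct odd positive primes such that $\left(\frac{p}{q}\right)=-1$ and such that $p$ or $q$ is congruent to $1$ modulo $4$. Then the quaternion algebra $H_K(p,q)$ is a division algebra if and only if $\left(\frac{-3}{p}\right)=1$ or $\left(\frac{-3}{q}\right)=1$.
   Context: For a field $F$ of characteristic $\neq 2$ and $a,b\in F\setminus\{0\}$, $H_F(a,b)$ denotes the generalized quaternion algebra over $F$ with basis $1,i,j,k$ and relations $i^2=a$, $j^2=b$, $ij=-ji=k$. $\left(\frac{m}{\ell}\right)$ is the Legendre symbol for an odd prime $\ell$, equal to $0$ if $\ell\mid m$. *)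

(* Defs.v *)
From HB Require Import structures.
From mathcomp Require Import all_boot all_order all_algebra all_field ring.

Set Implicit Arguments.
Unset Strict Implicit.
Unset Printing Implicit Defensive.

Import GRing.Theory.
Local Open Scope ring_scope.

(* [quat a b] is H_F(a, b): the quadruple (x0, x1, x2, x3) stands for
   x0 + x1 i + x2 j + x3 k.  The parameters a and b are unrestricted here;
   they are meant to be nonzero, and F of characteristic other than 2. *)
Record quat (F : fieldType) (a b : F) := Quat { q0 : F; q1 : F; q2 : F; q3 : F }.

Section Quaternion.
Variables (F : fieldType) (a b : F).
Local Notation H := (quat a b).
Local Notation Quat := (@Quat F a b).
Implicit Types x y z : H.

Definition prod_of_quat x := (q0 x, q1 x, q2 x, q3 x).
Definition quat_of_prod (t : F * F * F * F) : H :=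
  let: (t0, t1, t2, t3) := t in Quat t0 t1 t2 t3.

Lemma prod_of_quatK : cancel prod_of_quat quat_of_prod.
Proof. by case. Qed.

HB.instance Definition _ := Choice.copy H (can_type prod_of_quatK).

Lemma quatP x y :
  q0 x = q0 y -> q1 x = q1 y -> q2 x = q2 y -> q3 x = q3 y -> x = y.
Proof. by case: x => ????; case: y => ???? /= -> -> -> ->. Qed.

Definition addq x y :=
  Quat (q0 x + q0 y) (q1 x + q1 y) (q2 x + q2 y) (q3 x + q3 y).
Definition oppq x := Quat (- q0 x) (- q1 x) (- q2 x) (- q3 x).

Fact addqA : associative addq.
Proof. by move=> x y z; apply: quatP; rewrite /= addrA. Qed.
Fact addqC : commutative addq.
Proof. by move=> x y; apply: quatP; rewrite /= addrC. Qed.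
Fact add0q : left_id (Quat 0 0 0 0) addq.
Proof. by move=> x; apply: quatP; rewrite /= add0r. Qed.
Fact addNq : left_inverse (Quat 0 0 0 0) oppq addq.
Proof. by move=> x; apply: quatP; rewrite /= addNr. Qed.

HB.instance Definition _ := GRing.isZmodule.Build H addqA addqC add0q addNq.

(* The bilinear extension of i^2 = a, j^2 = b, ij = k = - ji; hence k^2 = - ab,
   ik = aj = - ki and kj = bi = - jk. *)
Definition mulq x y := Quat
  (q0 x * q0 y + a * q1 x * q1 y + b * q2 x * q2 y - a * b * q3 x * q3 y)
  (q0 x * q1 y + q1 x * q0 y + b * q3 x * q2 y - b * q2 x * q3 y)
  (q0 x * q2 y + q2 x * q0 y + a * q1 x * q3 y - a * q3 x * q1 y)
  (q0 x * q3 y + q3 x * q0 y + q1 x * q2 y - q2 x * q1 y).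

Fact mulqA : associative mulq.
Proof. by move=> x y z; apply: quatP => /=; ring. Qed.
Fact mul1q : left_id (Quat 1 0 0 0) mulq.
Proof. by move=> x; apply: quatP => /=; ring. Qed.
Fact mulq1 : right_id (Quat 1 0 0 0) mulq.
Proof. by move=> x; apply: quatP => /=; ring. Qed.
Fact mulqDl : left_distributive mulq addq.
Proof. by move=> x y z; apply: quatP => /=; ring. Qed.
Fact mulqDr : right_distributive mulq addq.
Proof. by move=> x y z; apply: quatP => /=; ring. Qed.
Fact oneq_neq0 : Quat 1 0 0 0 != 0.
Proof. by apply/eqP => -[] /eqP; rewrite oner_eq0. Qed.

HB.instance Definition _ :=
  GRing.Zmodule_isNzRing.Build H mulqA mul1q mulq1 mulqDl mulqDr oneq_neq0.

Definition scaleq (c : F) x := Quat (c * q0 x) (c * q1 x) (c * q2 x) (c * q3 x).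

Fact scaleqA c d x : scaleq c (scaleq d x) = scaleq (c * d) x.
Proof. by apply: quatP; rewrite /= mulrA. Qed.
Fact scale1q : left_id 1 scaleq.
Proof. by move=> x; apply: quatP; rewrite /= mul1r. Qed.
Fact scaleqDr : right_distributive scaleq +%R.
Proof. by move=> c x y; apply: quatP; rewrite /= mulrDr. Qed.
Fact scaleqDl x : {morph scaleq^~ x : c d / c + d}.
Proof. by move=> c d; apply: quatP; rewrite /= mulrDl. Qed.

HB.instance Definition _ :=
  GRing.Zmodule_isLmodule.Build F H scaleqA scale1q scaleqDr scaleqDl.

Fact scaleqAl (c : F) x y : c *: (x * y) = c *: x * y.
Proof. by apply: quatP => /=; ring. Qed.
Fact scaleqAr (c : F) x y : c *: (x * y) = x * (c *: y).
Proof. by apply: quatP => /=; ring. Qed.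

HB.instance Definition _ := GRing.Lmodule_isLalgebra.Build F H scaleqAl.
HB.instance Definition _ := GRing.Lalgebra_isAlgebra.Build F H scaleqAr.

Definition qi : H := Quat 0 1 0 0.
Definition qj : H := Quat 0 0 1 0.
Definition qk : H := Quat 0 0 0 1.

Lemma quat_basis (c0 c1 c2 c3 : F) :
  c0%:A + c1 *: qi + c2 *: qj + c3 *: qk = Quat c0 c1 c2 c3.
Proof. by apply: quatP => /=; ring. Qed.
Lemma qi_sqr : qi ^+ 2 = a%:A.
Proof. by apply: quatP => /=; ring. Qed.
Lemma qj_sqr : qj ^+ 2 = b%:A.
Proof. by apply: quatP => /=; ring. Qed.
Lemma qij : qi * qj = qk.
Proof. by apply: quatP => /=; ring. Qed.
Lemma qji : qj * qi = - qk.
Proof. by apply: quatP => /=; ring. Qed.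

End Quaternion.

Definition division_ring (D : nzRingType) : Prop :=
  forall x : D, x != 0 -> exists y : D, x * y = 1 /\ y * x = 1.

(* The value is the Legendre symbol only when l is an odd prime. *)
Definition legendre (m : int) (l : nat) : int :=
  if (l %| m)%Z then 0
  else if [exists x : 'I_l, (x%:Z ^+ 2 == m %[mod l])%Z] then 1 else -1.

Definition cubefree (m : int) : Prop :=
  forall l : nat, prime l -> ~~ (l%:Z ^+ 3 %| m)%Z.

(* Main.v *)
(* H_K(p, q) is a division algebra iff its norm form
   x0^2 - p x1^2 - q x2^2 + p q x3^2 is anisotropic over K, and by Springer's
   argument for the odd degree [K : F] this may be tested over F = Q(sqrt -3).
   Quadratic reciprocity makes p and q nonresidues of each other.  If -3 is a
   square mod q (or, symmetrically, mod p), F embeds in Q_q and the norm form of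
   the unramified extension Q_q(sqrt p) gives an infinite descent.  Otherwise, say
   with q = 1 mod 4: q = a^2 + b^2, and a pigeonhole argument in the style of
   Legendre's theorem solves Z^2 + 3 q X^2 = 3 p Y^2 (only p, q <> 3 need this).
   As -3 = s^2 in F, this says that Z + s X sqrt q has norm - p (s Y)^2, and
   multiplying by a + sqrt q, of norm - b^2, represents p. *)
Require Import Defs.
From HB Require Import structures.
From mathcomp Require Import all_boot all_order all_algebra all_field.
From mathcomp Require Import cyclic ring lra zify.

Set Implicit Arguments.
Unset Strict Implicit.
Unset Printing Implicit Defensive.

Import Order.TTheory GRing.Theory Num.Theory.
Local Open Scope ring_scope.

(** * The norm form and Springer's theorem in degree 3 *)

(** The reduced norm of H(a, b). The ring is left general because the form is evaluated over [int],
    [{poly F}], F and K. *)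
Definition nform (R : comNzRingType) (a b x0 x1 x2 x3 : R) : R :=
  x0 ^+ 2 - a * x1 ^+ 2 - b * x2 ^+ 2 + a * b * x3 ^+ 2.

Definition anisotropic (R : comNzRingType) (a b : R) : Prop :=
  forall x0 x1 x2 x3 : R, nform a b x0 x1 x2 x3 = 0 ->
    [/\ x0 = 0, x1 = 0, x2 = 0 & x3 = 0].

Lemma anisotropicC (R : comNzRingType) (a b : R) :
  anisotropic a b -> anisotropic b a.
Proof.
move=> an x0 x1 x2 x3 n0; have [|-> -> -> ->] // := an x0 x2 x1 x3.
by rewrite -n0 /nform; ring.
Qed.

Lemma quat_mul_conj (K : fieldType) (a b x0 x1 x2 x3 : K) :
  (Quat a b x0 x1 x2 x3 * Quat a b x0 (- x1) (- x2) (- x3) = (nform a b x0 x1 x2 x3)%:A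
     :> quat a b) /\
  (Quat a b x0 (- x1) (- x2) (- x3) * Quat a b x0 x1 x2 x3 = (nform a b x0 x1 x2 x3)%:A
     :> quat a b).
Proof. by rewrite /nform; split; apply: quatP => /=; ring. Qed.

(** The product of a quaternion with its conjugate is its norm: a zero norm produces zero divisors,
    and a nonzero norm makes the rescaled conjugate an inverse. *)
Lemma quat_divisionP (K : fieldType) (a b : K) :
  division_ring (quat a b) <-> anisotropic a b.
Proof.
split=> [divH x0 x1 x2 x3 n0 | an [x0 x1 x2 x3] nz].
  pose x : quat a b := Quat a b x0 x1 x2 x3.
  pose x' : quat a b := Quat a b x0 (- x1) (- x2) (- x3).
  have x'x : x' * x = 0 by rewrite (quat_mul_conj _ _ _ _ _ _).2 n0 scale0r.
  have [x_0|/divH[y [xy _]]] := eqVneq x 0; first by case: x_0.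
  have : x' = 0 by rewrite -[x']mulr1 -xy mulrA x'x mul0r.
  by case=> -> /eqP + /eqP + /eqP; rewrite !oppr_eq0 => /eqP-> /eqP-> /eqP->.
set N := nform a b x0 x1 x2 x3.
have [N0|N_nz] := eqVneq N 0.
  by have [e0 e1 e2 e3] := an _ _ _ _ N0; rewrite e0 e1 e2 e3 eqxx in nz.
have [xx' x'x] := quat_mul_conj a b x0 x1 x2 x3.
exists (N^-1 *: Quat a b x0 (- x1) (- x2) (- x3)).
by rewrite -scalerAr -scalerAl xx' x'x scalerA mulVf // scale1r.
Qed.

Lemma size_nform_leq (F : fieldType) (a b : F) (P0 P1 P2 P3 : {poly F}) n :
  (size P0 <= n.+1)%N -> (size P1 <= n.+1)%N ->
  (size P2 <= n.+1)%N -> (size P3 <= n.+1)%N ->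
  (size (nform a%:P b%:P P0 P1 P2 P3) <= n.*2.+1)%N.
Proof.
move=> s0 s1 s2 s3.
have sq (P : {poly F}) : (size P <= n.+1)%N -> (size (P ^+ 2) <= n.*2.+1)%N.
  move=> sP; rewrite expr2; apply: leq_trans (size_polyMleq _ _) _.
  by move: sP; case: (size P) => [|?]; lia.
have sqc (c : F) (P : {poly F}) :
    (size P <= n.+1)%N -> (size (c%:P * P ^+ 2)%R <= n.*2.+1)%N.
  by move=> /sq; apply: leq_trans; rewrite mul_polyC size_scale_leq.
have add (P Q : {poly F}) : (size P <= n.*2.+1)%N -> (size Q <= n.*2.+1)%N ->
    (size (P + Q)%R <= n.*2.+1)%N.
  by move=> sP sQ; rewrite (leq_trans (size_polyD _ _)) // geq_max sP.
by rewrite /nform -polyCM !add ?size_polyN ?sqc ?sq.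
Qed.

(* By anisotropy the leading coefficients of the four terms cannot cancel. *)
Lemma size_nform (F : fieldType) (a b : F) (P0 P1 P2 P3 : {poly F}) n :
  anisotropic a b ->
  (size P0 <= n.+1)%N -> (size P1 <= n.+1)%N ->
  (size P2 <= n.+1)%N -> (size P3 <= n.+1)%N ->
  (size (nform a%:P b%:P P0 P1 P2 P3) <= n.*2)%N ->
  [/\ size P0 <= n, size P1 <= n, size P2 <= n & size P3 <= n]%N.
Proof.
move=> an s0 s1 s2 s3 sN.
have coefsq (P : {poly F}) : (size P <= n.+1)%N -> (P ^+ 2)`_(n.*2) = P`_n ^+ 2.
  move=> sP; rewrite expr2 coefM.
  have lt_n : (n < n.*2.+1)%N by rewrite ltnS -addnn leq_addl.
  have dbl : (n.*2 - n)%N = n by rewrite -addnn addnK.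
  rewrite (bigD1 (Ordinal lt_n)) //= dbl big1 ?addr0 -?expr2 // => i ne.
  have [lt|le] := ltnP n i; first by rewrite nth_default ?mul0r // (leq_trans sP).
  rewrite [P`_(_ - i)]nth_default ?mulr0 // (leq_trans sP) //.
  have : (i != n :> nat) by apply: contra ne => /eqP e; apply/eqP/val_inj.
  by have := ltn_ord i; lia.
have drop (P : {poly F}) : (size P <= n.+1)%N -> P`_n = 0 -> (size P <= n)%N.
  move=> sP Pn; apply/leq_sizeP => j; rewrite leq_eqVlt => /predU1P[<- //|lt].
  by rewrite nth_default // (leq_trans sP).
have /an[] : nform a b P0`_n P1`_n P2`_n P3`_n = 0.
  rewrite -[RHS](@nth_default _ 0 _ (n.*2) sN) /nform -!coefsq //.
  by rewrite -polyCM !(coefD, coefN, coefCM).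
by move=> *; split; apply: drop.
Qed.

(** A vanishing norm satisfies the size bound of [size_nform] for every n, so a common bound on the
    four sizes can be lowered step by step to 0. *)
Lemma anisotropic_poly (F : fieldType) (a b : F) :
  anisotropic a b -> anisotropic a%:P b%:P.
Proof.
move=> an P0 P1 P2 P3 N0.
have aux n : (size P0 <= n -> size P1 <= n -> size P2 <= n -> size P3 <= n ->
   [/\ size P0 <= 0, size P1 <= 0, size P2 <= 0 & size P3 <= 0])%N.
  elim: n => [|n IHn] s0 s1 s2 s3; first by split.
  have sN : (size (nform a%:P b%:P P0 P1 P2 P3) <= n.*2)%N.
    by rewrite N0 size_poly0.
  by case: (size_nform an s0 s1 s2 s3 sN); apply: IHn.
pose m := maxn (maxn (size P0) (size P1)) (maxn (size P2) (size P3)).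
have [|||| s0 s1 s2 s3] := aux m; rewrite /m; try lia.
by split; apply/eqP; rewrite -size_poly_leq0.
Qed.

(* Springer's theorem in degree 3: a zero over F[t]/(f) lifts to polynomials of
   degree at most 2 whose norm is f times a linear factor; the root of that
   factor divides all four polynomials, and dividing it out contradicts the
   degree of f. *)
Lemma springer_cubic (F : fieldType) (a b : F) (f P0 P1 P2 P3 : {poly F}) :
  anisotropic a b -> irreducible_poly f -> size f = 4%N ->
  (size P0 <= 3)%N -> (size P1 <= 3)%N -> (size P2 <= 3)%N -> (size P3 <= 3)%N ->
  f %| nform a%:P b%:P P0 P1 P2 P3 ->
  [/\ P0 = 0, P1 = 0, P2 = 0 & P3 = 0].
Proof.
move=> an irf sf s0 s1 s2 s3 /dvdpP[h Nh].
have f_nz : f != 0 by rewrite -size_poly_eq0 sf.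
(* Linear entries have a norm of degree at most 2, which the cubic [f] divides only if it is
   zero. *)
have small (Q0 Q1 Q2 Q3 : {poly F}) : (size Q0 <= 2)%N -> (size Q1 <= 2)%N ->
    (size Q2 <= 2)%N -> (size Q3 <= 2)%N ->
    f %| nform a%:P b%:P Q0 Q1 Q2 Q3 ->
    [/\ Q0 = 0, Q1 = 0, Q2 = 0 & Q3 = 0].
  move=> t0 t1 t2 t3 fN; apply: (anisotropic_poly an).
  apply/eqP; apply: contraT => nz; have := dvdp_leq nz fN; rewrite sf.
  by move=> /leq_trans/(_ (@size_nform_leq _ a b _ _ _ _ 1 t0 t1 t2 t3)).
have sN : (size (nform a%:P b%:P P0 P1 P2 P3) <= 5)%N 
  by exact: (@size_nform_leq _ a b _ _ _ _ 2).
have [h0|h_nz] := eqVneq h 0.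
  by apply: (anisotropic_poly an); rewrite Nh h0 mul0r.
have sNE : size (nform a%:P b%:P P0 P1 P2 P3) = (size h).+3.
  by rewrite Nh size_mul // sf addnC.
have sh : (size h <= 2)%N by rewrite sNE in sN.
(* A constant [h] gives a norm of degree 3 < 4, so the leading coefficients cancel and all four
   degrees drop to at most 1. *)
have [sh1|sh2] := leqP (size h) 1.
  have sN4 : (size (nform a%:P b%:P P0 P1 P2 P3) <= 2.*2)%N.
    by rewrite sNE.
  case: (size_nform an s0 s1 s2 s3 sN4) => t0 t1 t2 t3.
  by apply: small => //; rewrite Nh dvdp_mull.
have [|r hr] := @poly2_root _ h.
  by apply/eqP; rewrite eqn_leq sh.
have vanish : nform a b P0.[r] P1.[r] P2.[r] P3.[r] = 0.
  have := congr1 (horner^~ r) Nh; rewrite hornerM (rootP hr) mul0r => <-.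
  by rewrite /nform -polyCM !hornerE.
have factor (P : {poly F}) : (size P <= 3)%N -> P.[r] = 0 ->
    exists2 Q : {poly F}, P = Q * ('X - r%:P) & (size Q <= 2)%N.
  move=> sP /eqP/factor_theorem[Q PQ]; exists Q => //.
  have [-> | Qnz] := eqVneq Q 0; first by rewrite size_poly0.
  by move: sP; rewrite PQ size_Mmonic ?monicXsubC // size_XsubC; lia.
have [/(factor _ s0)[Q0 P0E t0] /(factor _ s1)[Q1 P1E t1]
      /(factor _ s2)[Q2 P2E t2] /(factor _ s3)[Q3 P3E t3]] := an _ _ _ _ vanish.
have NQ : nform a%:P b%:P P0 P1 P2 P3 =
          nform a%:P b%:P Q0 Q1 Q2 Q3 * ('X - r%:P) ^+ 2.
  by rewrite /nform P0E P1E P2E P3E; ring.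
suff /(small _ _ _ _ t0 t1 t2 t3)[z0 z1 z2 z3] :
    f %| nform a%:P b%:P Q0 Q1 Q2 Q3
  by rewrite P0E P1E P2E P3E z0 z1 z2 z3 !mul0r.
(* The irreducible cubic [f] is coprime to X - r, so it still divides the norm once (X - r)^2 is
   removed. *)
rewrite -(@Gauss_dvdpl _ _ (('X - r%:P) ^+ 2)) -?NQ ?Nh ?dvdp_mull //.
rewrite coprimep_expr // irreducible_poly_coprime //.
by apply/negP => /dvdp_leq; rewrite polyXsubC_eq0 sf size_XsubC => /(_ isT).
Qed.

Lemma nform_morph (R S : comNzRingType) (g : {rmorphism R -> S})
    (a b x0 x1 x2 x3 : R) :
  g (nform a b x0 x1 x2 x3) = nform (g a) (g b) (g x0) (g x1) (g x2) (g x3).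
Proof. by rewrite /nform !(rmorphD, rmorphN, rmorphM, rmorphXn). Qed.

Lemma prim3_root_eq (R : idomainType) (eps : R) :
  3.-primitive_root eps -> eps ^+ 2 + eps + 1 = 0.
Proof.
move=> eps3; have e1 : eps - 1 != 0.
  by rewrite subr_eq0 -[eps]expr1 -(prim_order_dvd eps3).
apply: (mulfI e1); rewrite mulr0 -[RHS](subrr 1) -{3}(prim_expr_order eps3).
by ring.
Qed.

(** Reduction modulo [f] leaves the value at [beta] unchanged. It serves both for X^3 - alpha over F
    and for X^2 + X + 1 over Q. *)
Lemma adjoin_horner_alg (F : fieldType) (K : fieldExtType F) (beta : K)
    (f : {poly F}) :
  <<1; beta>>%VS = fullv -> f != 0 -> horner_alg beta f = 0 ->
  forall x : K, exists2 P : {poly F}, (size P < size f)%N & horner_alg beta P = x.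
Proof.
move=> genK f_nz evf x; have := memvf x; rewrite -genK => /Fadjoin_poly_eq.
have /polyOver1P[P ->] := Fadjoin_polyOver 1 beta x => PE.
exists (P %% f); first by rewrite ltn_modp.
rewrite -[RHS]PE -[RHS]/(horner_alg beta P) [in RHS](divp_eq P f).
by rewrite rmorphD rmorphM /= evf mulr0 add0r.
Qed.

Lemma anisotropic_kummer (F : fieldType) (K : fieldExtType F) (eps alpha a b : F)
    (beta : K) :
  3.-primitive_root eps -> beta ^+ 3 = alpha%:A -> <<1; beta>>%VS = fullv ->
  anisotropic a b -> anisotropic (a%:A : K) b%:A.
Proof.
move=> eps3 beta3 genK an x0 x1 x2 x3 N0.
(* [alpha] may be a cube in F, as -1 is; then K = F and the zero already lies in F. *)
have [beta1 | betaN1] := boolP (beta \in 1%VS).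
  have lift (x : K) : exists y : F, x = y%:A.
    by apply/vlineP; rewrite (Fadjoin_idP (K := 1%AS) beta1) in genK; rewrite genK memvf.
  have [[y0 y0E] [y1 y1E] [y2 y2E] [y3 y3E]] :=
    And4 (lift x0) (lift x1) (lift x2) (lift x3).
  have : nform a b y0 y1 y2 y3 = 0.
    apply: (fmorph_inj (in_alg K)); rewrite nform_morph rmorph0 -[RHS]N0.
    by rewrite y0E y1E y2E y3E.
  by case/an => z0 z1 z2 z3; rewrite y0E y1E y2E y3E z0 z1 z2 z3 scale0r.
pose f : {poly F} := 'X^3 - alpha%:P.
have sf : size f = 4%N by rewrite size_XnsubC.
have f_nz : f != 0 by rewrite -size_poly_eq0 sf.
have evf : horner_alg beta f = 0.
  by rewrite rmorphB rmorphXn /= horner_algX horner_algC beta3 subrr.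
have irf : irreducible_poly f.
  apply: cubic_irreducible; rewrite ?sf // => r; apply: contra betaN1 => /eqP.
  rewrite !hornerE => /eqP; rewrite subr_eq0 => /eqP r3.
  have e0 : eps%:A ^+ 2 + eps%:A + 1 = 0 :> K.
    have := congr1 (in_alg K) (prim3_root_eq eps3).
    by rewrite !rmorphD rmorphXn rmorph1 rmorph0.
  (* A root r in F would force [beta] to be r, eps r or eps^2 r, all in F. The expansion carries an
     explicit multiple of eps^2 + eps + 1, so that it becomes a plain ring identity. *)
  have : (beta - r%:A) * (beta - eps%:A * r%:A) * (beta - eps%:A ^+ 2 * r%:A) = 0.
    have -> : (beta - r%:A) * (beta - eps%:A * r%:A) * (beta - eps%:A ^+ 2 * r%:A)
      = beta ^+ 3 - r%:A ^+ 3 + (eps%:A ^+ 2 + eps%:A + 1) *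
        (eps%:A * r%:A ^+ 2 * beta - r%:A * beta ^+ 2 - (eps%:A - 1) * r%:A ^+ 3).
      by ring.
    by rewrite e0 mul0r addr0 beta3 -r3 -[(_ ^+ 3)%:A]/(in_alg K _) rmorphXn subrr.
  move/eqP; rewrite !mulf_eq0 !subr_eq0 -orbA.
  have algE c : c%:A \in (1%AS : {aspace K}) by rewrite memvZ ?mem1v.
  by case/or3P => /eqP->; rewrite ?(rpredM _ (algE r)) ?rpredX ?algE.
have lift (x : K) : exists2 P : {poly F}, (size P <= 3)%N & horner_alg beta P = x.
  by have [P sP PE] := adjoin_horner_alg genK f_nz evf x; exists P; rewrite // -ltnS -sf.
have [[P0 s0 P0E] [P1 s1 P1E] [P2 s2 P2E] [P3 s3 P3E]] :=
  And4 (lift x0) (lift x1) (lift x2) (lift x3).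
have NP : horner_alg beta (nform a%:P b%:P P0 P1 P2 P3) = 0.
  by rewrite nform_morph /= !horner_algC P0E P1E P2E P3E.
suff /(springer_cubic an irf sf s0 s1 s2 s3)[z0 z1 z2 z3] :
    f %| nform a%:P b%:P P0 P1 P2 P3.
  by rewrite -P0E -P1E -P2E -P3E z0 z1 z2 z3 rmorph0.
(* Otherwise [f] and the norm are coprime, and a Bezout relation evaluated at [beta] reads 0 = 1. *)
apply: contraT; rewrite -irreducible_poly_coprime // => /Bezout_eq1_coprimepP[u].
move/(congr1 (horner_alg beta)); rewrite rmorphD !rmorphM rmorph1 /=.
by rewrite evf NP !mulr0 addr0 => /esym/eqP; rewrite oner_eq0.
Qed.

(** * Descent at a prime where -3 is a square *)

Lemma dvdz_Fp (q : nat) (m : int) :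
  prime q -> (q %| m)%Z = (m%:~R == 0 :> 'F_q).
Proof. by move=> pq; rewrite (dvdz_pcharf (pchar_Fp pq)). Qed.

Lemma Euclid_dvdzM (q : nat) (m n : int) :
  prime q -> (q %| m * n)%Z = (q %| m)%Z || (q %| n)%Z.
Proof. by move=> pq; rewrite !dvdz_Fp // rmorphM mulf_eq0. Qed.

(** Zero counts as a square, so a nonsquare is automatically nonzero. *)
Definition is_square (F : finFieldType) (a : F) := [exists x : F, x ^+ 2 == a].

Lemma legendre_exists (m : int) (l : nat) : prime l ->
  [exists x : 'I_l, (x%:Z ^+ 2 == m %[mod l])%Z] =
  is_square (m%:~R : 'F_l).
Proof.
move=> pl; have sqE (x : nat) :
    (x%:Z ^+ 2 == m %[mod l])%Z = (x%:R ^+ 2 == m%:~R :> 'F_l).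
  by rewrite eqz_mod_dvd dvdz_Fp // rmorphB rmorphXn subr_eq0.
apply/existsP/existsP => -[x].
  by rewrite sqE; exists x%:R.
have ltx : (x < l)%N by rewrite -[l in (_ < l)%N](Fp_cast pl) ltn_ord.
by move=> xm; exists (Ordinal ltx); rewrite sqE /= natr_Zp.
Qed.

Lemma legendreN1 (m : int) (l : nat) : prime l ->
  legendre m l = -1 <-> ~~ is_square (m%:~R : 'F_l).
Proof.
move=> pl; rewrite /legendre legendre_exists // dvdz_Fp // /is_square.
case: eqP => [->|_]; last by case: existsP.
split=> // /existsPn/(_ 0); by rewrite expr0n eqxx.
Qed.

Lemma legendre1 (m : int) (l : nat) : prime l ->
  legendre m l = 1 <-> m%:~R != 0 :> 'F_l /\ is_square (m%:~R : 'F_l).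
Proof.
move=> pl; rewrite /legendre legendre_exists // dvdz_Fp // /is_square.
by case: eqP => [->|_]; [split=> // -[] | case: existsP => _; split=> // -[]].
Qed.

Lemma dvdz_norm_nonresidue (q : nat) (p x y : int) : prime q ->
  ~~ is_square (p%:~R : 'F_q) ->
  (q %| x ^+ 2 - p * y ^+ 2)%Z -> (q %| x)%Z /\ (q %| y)%Z.
Proof.
move=> pq nsq; rewrite !dvdz_Fp // rmorphB rmorphXn rmorphM rmorphXn /= subr_eq0.
have [-> | y_nz] := eqVneq (y%:~R : 'F_q) 0.
  by rewrite expr0n mulr0 sqrf_eq0.
move=> /eqP xy; case/negP: nsq; apply/existsP; exists (x%:~R / y%:~R).
by rewrite exprMn xy exprVn mulfK // sqrf_eq0.
Qed.

(** Modulo q the form is y0^2 - p y1^2, so q divides y0 and y1; after division by q, what remains is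
    y2^2 - p y3^2 up to sign, so q divides y2 and y3. Each round removes q^2 from the norm and q
    from every coordinate. *)
Lemma nform_descent (q : nat) (p : int) : prime q ->
  ~~ is_square (p%:~R : 'F_q) ->
  forall m (y0 y1 y2 y3 : int), (q%:Z ^+ m.*2 %| nform p q%:Z y0 y1 y2 y3)%Z ->
    [/\ q%:Z ^+ m %| y0, q%:Z ^+ m %| y1, q%:Z ^+ m %| y2 & q%:Z ^+ m %| y3]%Z.
Proof.
move=> pq nsq; have q_nz : q%:Z != 0 by rewrite eqz_nat -lt0n prime_gt0.
elim=> [|m IHm] y0 y1 y2 y3 qN; first by rewrite !dvd1z.
have [] := @dvdz_norm_nonresidue q p y0 y1 pq nsq.
  have : (q %| nform p q y0 y1 y2 y3)%Z.
    by apply: dvdz_trans qN; rewrite doubleS exprS dvdz_mulr.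
  have -> : nform p q y0 y1 y2 y3 = y0 ^+ 2 - p * y1 ^+ 2 + (p * y3 ^+ 2 - y2 ^+ 2) * q.
    by rewrite /nform; ring.
  by rewrite rpredDr ?dvdz_mull.
move=> /dvdzP[z0 y0E] /dvdzP[z1 y1E].
have [] := @dvdz_norm_nonresidue q p y2 y3 pq nsq.
  move: qN; rewrite doubleS [_ ^+ _.*2.+2]exprS.
  have -> : nform p q y0 y1 y2 y3 =
      q%:Z * (q%:Z * (z0 ^+ 2 - p * z1 ^+ 2) - (y2 ^+ 2 - p * y3 ^+ 2)).
    by rewrite /nform y0E y1E; ring.
  rewrite dvdz_mul2l // [_ ^+ _.*2.+1]exprS => qN.
  rewrite -(rpredBl _ (dvdz_mulr (z0 ^+ 2 - p * z1 ^+ 2) (dvdzz q))).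
  by apply: dvdz_trans qN; apply: dvdz_mulr.
move=> /dvdzP[z2 y2E] /dvdzP[z3 y3E].
have [|d0 d1 d2 d3] := IHm z0 z1 z2 z3.
  move: qN; rewrite doubleS [_ ^+ _.*2.+2]exprS [_ ^+ _.*2.+1]exprS mulrA.
  have -> : nform p q y0 y1 y2 y3 = (q%:Z * q%:Z) * nform p q z0 z1 z2 z3.
    by rewrite /nform y0E y1E y2E y3E; ring.
  by rewrite dvdz_mul2l ?mulf_neq0.
by rewrite y0E y1E y2E y3E exprSr !dvdz_mul2r.
Qed.

(** Hensel lifting: c is corrected by t q^(n+1), where t solves k + 2 c t = 0 modulo q and k is the
    quotient of c^2 - d by q^(n+1). The inverse of 2c exists because q is odd and does not divide
    d. *)
Lemma sqrt_lift (q : nat) (d c0 : int) : prime q -> odd q -> ~~ (q %| d)%Z ->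
  (q %| c0 ^+ 2 - d)%Z -> forall n, exists c : int, (q%:Z ^+ n %| c ^+ 2 - d)%Z.
Proof.
move=> pq oq qNd qc0; suff lift n : exists c : int, (q%:Z ^+ n.+1 %| c ^+ 2 - d)%Z.
  case=> [|n]; last exact: lift.
  by exists 0; rewrite dvd1z.
elim: n => [|n [c /dvdzP[k ck]]]; first by exists c0.
have q2c : ~~ (q %| 2 * c)%Z.
  rewrite Euclid_dvdzM // negb_or; apply/andP; split.
    by rewrite dvdzE dvdn_prime2 //; apply: contraL oq; rewrite absz_nat => /eqP->.
  apply: contra qNd => qc; rewrite -(rpredBl _ (dvdz_exp (isT : 0 < 2)%N qc)).
  by rewrite ck exprS dvdz_mull // dvdz_mulr.
have [t /dvdzP[w tw]] : exists t : int, (q %| k + 2 * c * t)%Z.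
  have : coprimez q (2 * c) by rewrite coprimezE prime_coprime.
  move=> /eqP cop; have [u [v uv]] := Bezoutz q (2 * c); rewrite cop in uv.
  exists (- k * v); apply/dvdzP; exists (k * u).
  have -> : k + 2 * c * (- k * v) = k - k * (v * (2 * c)) by ring.
  have -> : v * (2 * c) = 1 - u * q by rewrite -[X in X - _]uv addrAC subrr add0r.
  by ring.
exists (c + t * q%:Z ^+ n.+1); apply/dvdzP.
exists (w + t ^+ 2 * q%:Z ^+ n).
have -> : (c + t * q%:Z ^+ n.+1) ^+ 2 - d =
   c ^+ 2 - d + 2 * c * t * q%:Z ^+ n.+1 + t ^+ 2 * q%:Z ^+ n.+1 ^+ 2 by ring.
rewrite ck -mulrDl tw !exprS; ring.
Qed.

Lemma dvdz_exp_eq0 (q : nat) (m : int) :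
  (1 < q)%N -> (forall n, (q%:Z ^+ n %| m)%Z) -> m = 0.
Proof.
move=> q_gt1 /(_ `|m|%N); rewrite dvdzE abszX => dvd_m; apply/eqP.
rewrite -absz_eq0; apply: contraLR dvd_m => m_nz.
by apply/negP => /dvdn_leq; rewrite lt0n => /(_ m_nz); rewrite leqNgt ltn_expl.
Qed.

(** The two equations are the rational part and half the sqrt(-3) part of the norm at the u_i + v_i
    sqrt(-3). Replacing sqrt(-3) by a root c of -3 modulo q^(2n) and descending shows that q^n
    divides u_i + v_i c, hence u_i^2 + 3 v_i^2. As n is arbitrary, this positive definite form
    vanishes. *)
Lemma nform_split_int (q : nat) (p : int) : prime q -> odd q ->
  ~~ is_square (p%:~R : 'F_q) -> legendre (-3) q = 1 ->
  forall u0 v0 u1 v1 u2 v2 u3 v3 : int,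
  nform p q u0 u1 u2 u3 - 3 * nform p q v0 v1 v2 v3 = 0 ->
  u0 * v0 - p * (u1 * v1) - q%:Z * (u2 * v2) + p * q%:Z * (u3 * v3) = 0 ->
  [/\ u0 = 0 /\ v0 = 0, u1 = 0 /\ v1 = 0, u2 = 0 /\ v2 = 0 & u3 = 0 /\ v3 = 0].
Proof.
move=> pq oq nsq /(legendre1 _ pq)[m3nz /existsP[r /eqP r2]].
move=> u0 v0 u1 v1 u2 v2 u3 v3 A0 B0.
have lift n : exists c : int, (q%:Z ^+ n %| c ^+ 2 - (-3))%Z.
  apply: (@sqrt_lift _ _ (r : nat)) => //; first by rewrite dvdz_Fp.
  by rewrite dvdz_Fp // rmorphB rmorphXn /= -pmulrn natr_Zp r2 subrr.
have key n : let Q := q%:Z ^+ n in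
    [/\ Q %| u0 ^+ 2 + 3 * v0 ^+ 2, Q %| u1 ^+ 2 + 3 * v1 ^+ 2,
        Q %| u2 ^+ 2 + 3 * v2 ^+ 2 & Q %| u3 ^+ 2 + 3 * v3 ^+ 2]%Z.
  have [c qc] := lift n.*2.
  have [|d0 d1 d2 d3] := @nform_descent q p pq nsq n
      (u0 + v0 * c) (u1 + v1 * c) (u2 + v2 * c) (u3 + v3 * c).
    have -> : nform p q (u0 + v0 * c) (u1 + v1 * c) (u2 + v2 * c) (u3 + v3 * c) =
      (nform p q u0 u1 u2 u3 - 3 * nform p q v0 v1 v2 v3) +
      2 * c * (u0 * v0 - p * (u1 * v1) - q%:Z * (u2 * v2) + p * q%:Z * (u3 * v3)) +
      nform p q v0 v1 v2 v3 * (c ^+ 2 - (-3)) by rewrite /nform; ring.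
    by rewrite A0 B0 mulr0 !add0r dvdz_mull.
  have {}qc : (q%:Z ^+ n %| c ^+ 2 - (-3))%Z.
    by apply: dvdz_trans qc; apply: dvdz_exp2l; rewrite -addnn leq_addr.
  have fin (u v : int) : (q%:Z ^+ n %| u + v * c)%Z -> (q%:Z ^+ n %| u ^+ 2 + 3 * v ^+ 2)%Z.
    move=> d; have -> : u ^+ 2 + 3 * v ^+ 2 =
      (u + v * c) * (u - v * c) + v ^+ 2 * (c ^+ 2 - (-3)) by ring.
    by apply: rpredD; [apply: dvdz_mulr | apply: dvdz_mull].
  by split; apply: fin.
have fin (u v : int) :
    (forall n, (q%:Z ^+ n %| u ^+ 2 + 3 * v ^+ 2)%Z) -> u = 0 /\ v = 0.
  move=> /(dvdz_exp_eq0 (prime_gt1 pq)) uv0.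
  have := sqr_ge0 u; have := sqr_ge0 v.
  have [/eqP u0'|u_nz] := boolP (u ^+ 2 == 0).
    by move: uv0; rewrite u0' => ?; split; apply/eqP; rewrite -sqrf_eq0; lia.
  by split; lia.
by split; apply: fin => n; have [] := key n.
Qed.

Lemma rat_ext_intr_eq0 (F : fieldExtType rat) (m : int) :
  (m%:~R == 0 :> F) = (m == 0).
Proof.
have -> : m%:~R = in_alg F m%:~R by rewrite rmorph_int.
by rewrite fmorph_eq0 intr_eq0.
Qed.

Lemma anisotropic_split (F : fieldExtType rat) (eps : F) (p q : nat) :
  3.-primitive_root eps -> <<1; eps>>%VS = fullv -> prime q -> odd q ->
  ~~ is_square (p%:R : 'F_q) -> legendre (-3) q = 1 ->
  anisotropic (p%:R : F) q%:R.
Proof.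
move=> eps3 genF pq oq nsq leg3.
pose s : F := 2 * eps + 1.
have s2 : s ^+ 2 = -3.
  have e0 := prim3_root_eq eps3.
  have -> : s ^+ 2 = 4 * (eps ^+ 2 + eps + 1) - 3 by rewrite /s; ring.
  by rewrite e0 mulr0 add0r.
have clear_denom (x : F) : exists d u v : int, d != 0 /\ d%:~R * x = u%:~R + v%:~R * s.
  pose f : {poly rat} := 'X^2 + 'X + 1.
  have sf : size f = 3%N.
    by rewrite /f -addrA size_polyDl size_polyXn // -polyC1 size_XaddC.
  have f_nz : f != 0 by rewrite -size_poly_eq0 sf.
  have evf : horner_alg eps f = 0.
    by rewrite !rmorphD rmorphXn rmorph1 /= horner_algX prim3_root_eq.
  have [P sP <-] := adjoin_horner_alg genF f_nz evf x.
  have PE : P = (P`_0)%:P + (P`_1)%:P * 'X.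
    apply/polyP => i; rewrite coefD coefC coefCM coefX.
    case: i => [|[|i]] /=; rewrite ?mulr0 ?mulr1 ?addr0 ?add0r //.
    by rewrite nth_default // -ltnS; apply: leq_trans sP _; rewrite sf.
  pose d0 := denq P`_0; pose d1 := denq P`_1.
  pose a := numq P`_0; pose b := numq P`_1.
  (* Obtained from P0 + P1 eps with eps = (s - 1) / 2. *)
  exists (2 * d0 * d1), (2 * a * d1 - b * d0), (b * d0).
  split; first by rewrite !mulf_neq0 ?denq_neq0.
  have -> : horner_alg eps P = (P`_0)%:A + (P`_1)%:A * eps.
    by rewrite [in LHS]PE rmorphD (rmorphM (horner_alg eps)) /= !horner_algC horner_algX.
  have clr (r : rat) : (numq r)%:~R = (denq r)%:~R * r%:A :> F.
    rewrite -(rmorph_int (in_alg F)) -(rmorph_int (in_alg F) (denq r)).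
    by rewrite -[r%:A]/(in_alg F r) -rmorphM numqE mulrC.
  rewrite /s !(rmorphB, rmorphM) /= -/d0 -/d1.
  by rewrite /a /b !clr; ring.
move=> x0 x1 x2 x3 N0.
have [d0 [u0 [v0 [d0nz x0E]]]] := clear_denom x0.
have [d1 [u1 [v1 [d1nz x1E]]]] := clear_denom x1.
have [d2 [u2 [v2 [d2nz x2E]]]] := clear_denom x2.
have [d3 [u3 [v3 [d3nz x3E]]]] := clear_denom x3.
pose D : int := d0 * d1 * d2 * d3.
have Dnz : D%:~R != 0 :> F by rewrite rat_ext_intr_eq0 !mulf_neq0.
pose U0 := d1 * d2 * d3 * u0; pose V0 := d1 * d2 * d3 * v0.
pose U1 := d0 * d2 * d3 * u1; pose V1 := d0 * d2 * d3 * v1.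
pose U2 := d0 * d1 * d3 * u2; pose V2 := d0 * d1 * d3 * v2.
pose U3 := d0 * d1 * d2 * u3; pose V3 := d0 * d1 * d2 * v3.
have X0E : D%:~R * x0 = U0%:~R + V0%:~R * s.
  by rewrite /D /U0 /V0 !rmorphM /= -!mulrA -!mulrDr -x0E; ring.
have X1E : D%:~R * x1 = U1%:~R + V1%:~R * s.
  by rewrite /D /U1 /V1 !rmorphM /= -!mulrA -!mulrDr -x1E; ring.
have X2E : D%:~R * x2 = U2%:~R + V2%:~R * s.
  by rewrite /D /U2 /V2 !rmorphM /= -!mulrA -!mulrDr -x2E; ring.
have X3E : D%:~R * x3 = U3%:~R + V3%:~R * s.
  by rewrite /D /U3 /V3 !rmorphM /= -!mulrA -!mulrDr -x3E; ring.
pose A := nform p%:Z q U0 U1 U2 U3 - 3 * nform p%:Z q V0 V1 V2 V3.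
pose B := U0 * V0 - p%:Z * (U1 * V1) - q%:Z * (U2 * V2) + p%:Z * q%:Z * (U3 * V3).
have AB : A%:~R + 2 * B%:~R * s = 0 :> F.
  have : D%:~R ^+ 2 * nform p%:R q%:R x0 x1 x2 x3 =
         nform p%:R q%:R (D%:~R * x0) (D%:~R * x1) (D%:~R * x2) (D%:~R * x3).
    by rewrite /nform; ring.
  rewrite N0 mulr0 X0E X1E X2E X3E => ->.
  have -> : A%:~R = nform p%:R q%:R U0%:~R U1%:~R U2%:~R U3%:~R -
                    3 * nform p%:R q%:R V0%:~R V1%:~R V2%:~R V3%:~R :> F.
    by rewrite rmorphB (rmorphM _ 3) /= !nform_morph.
  have -> : B%:~R = U0%:~R * V0%:~R - p%:R * (U1%:~R * V1%:~R) -
      q%:R * (U2%:~R * V2%:~R) + p%:R * q%:R * (U3%:~R * V3%:~R) :> F.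
    by rewrite rmorphD !rmorphB !rmorphM.
  have s20 : s ^+ 2 - (-3) = 0 by rewrite s2 subrr.
  rewrite -[LHS]addr0 -[X in _ + X](mulr0 (nform p%:R q%:R V0%:~R V1%:~R V2%:~R V3%:~R)) -s20 /nform.
  by ring.
(* As s^2 = -3, the relation A = - 2 B s squares to A^2 + 12 B^2 = 0, and both terms are
   nonnegative. *)
have [A0 B0] : A = 0 /\ B = 0.
  have : (A ^+ 2 + 12 * B ^+ 2)%:~R == 0 :> F.
    have A_E : A%:~R = - (2 * B%:~R * s) :> F by apply/eqP; rewrite -addr_eq0 AB.
    rewrite rmorphD rmorphM !rmorphXn /= A_E sqrrN !exprMn s2; apply/eqP; ring.
  rewrite rat_ext_intr_eq0 => /eqP; have := sqr_ge0 A; have := sqr_ge0 B.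
  by move=> *; split; apply/eqP; rewrite -sqrf_eq0; lia.
have [[z0 w0] [z1 w1] [z2 w2] [z3 w3]] :=
  @nform_split_int q p pq oq nsq leg3 _ _ _ _ _ _ _ _ A0 B0.
have fin (x : F) U V : D%:~R * x = U%:~R + V%:~R * s -> U = 0 -> V = 0 -> x = 0.
  move=> xE U0' V0'; apply: (mulfI Dnz); rewrite xE U0' V0'; ring.
split; [exact: (fin _ _ _ X0E) | exact: (fin _ _ _ X1E)
       | exact: (fin _ _ _ X2E) | exact: (fin _ _ _ X3E)].
Qed.

(** * Quadratic reciprocity *)

Lemma finField_prim_root (F : finFieldType) :
  exists g : F, #|F|.-1.-primitive_root g.
Proof.
have n_gt0 : (0 < #|F|.-1)%N by rewrite -ltnS prednK ?finNzRing_gt1 // ltnW ?finNzRing_gt1.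
suff /hasP[g _ gP] : has #|F|.-1.-primitive_root (enum [pred x : F | x != 0]).
  by exists g.
apply: has_prim_root => //.
- apply/allP => x; rewrite mem_enum inE unity_rootE => x_nz.
  apply/eqP/(mulfI x_nz); rewrite -exprS prednK ?expf_card ?mulr1 //.
  by rewrite ltnW ?finNzRing_gt1.
- exact: enum_uniq.
- by rewrite -cardE -(cardC1 (0 : F)).
Qed.

Lemma finField_prim_rootP (F : finFieldType) (g x : F) :
  #|F|.-1.-primitive_root g -> x != 0 -> exists i, x = g ^+ i.
Proof.
move=> gP x_nz; have [|i ->] := prim_rootP gP (x := x); last by exists i.
apply: (mulfI x_nz); rewrite -exprS prednK ?expf_card ?mulr1 //.
by rewrite ltnW ?finNzRing_gt1.
Qed.

(** Nonsquares are odd powers of a generator of the multiplicative group, and a sum of two odd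
    exponents is even. *)
Lemma is_squareM_non (F : finFieldType) (a b : F) :
  ~~ is_square a -> ~~ is_square b -> is_square (a * b).
Proof.
have [g gP] := finField_prim_root F.
have nsq c : ~~ is_square c -> exists i, c = g ^+ i.*2.+1.
  move=> nsq_c; have c_nz : c != 0.
    by apply: contra nsq_c => /eqP->; apply/existsP; exists 0; rewrite expr0n.
  have [i cE] := finField_prim_rootP gP c_nz.
  exists i./2; rewrite cE -[in LHS](odd_double_half i); congr (_ ^+ _).
  case: (boolP (odd i)) => // ev; case/negP: nsq_c; apply/existsP; exists (g ^+ i./2).
  by rewrite cE -[in X in _ == X](odd_double_half i) (negPf ev) -exprM muln2.
move=> /nsq[i ->] /nsq[j ->]; apply/existsP; exists (g ^+ (i + j).+1).
by rewrite -exprM -exprD; apply/eqP; congr (_ ^+ _); lia.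
Qed.

Lemma is_squareM (F : finFieldType) (a b : F) :
  is_square a -> is_square b -> is_square (a * b).
Proof.
move=> /existsP[x /eqP<-] /existsP[y /eqP<-].
by apply/existsP; exists (x * y); rewrite exprMn.
Qed.

Lemma is_squareMl (F : finFieldType) (a b : F) :
  a != 0 -> is_square a -> is_square (a * b) = is_square b.
Proof.
move=> a_nz sqa; apply/idP/idP; last exact: is_squareM.
case/existsP: sqa a_nz => x /eqP <-; rewrite sqrf_eq0 => x_nz /existsP[y /eqP yE].
by apply/existsP; exists (y / x); rewrite exprMn yE exprVn mulrAC mulfV ?mul1r // sqrf_eq0.
Qed.

(** An element of order 4 exists and squares to -1. *)
Lemma is_squareN1 (p : nat) : prime p -> p = 1 %[mod 4] -> is_square (-1 : 'F_p).
Proof.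
move=> pp p1; have [g gP] := finField_prim_root 'F_p.
rewrite card_Fp // in gP; have p_gt1 := prime_gt1 pp.
have /(dvdn_prim_root gP) : (4 %| p.-1)%N by lia.
set i := g ^+ _ => iP; apply/existsP; exists i.
have : (i ^+ 2 - 1) * (i ^+ 2 + 1) == 0.
  by rewrite -subr_sqr expr1n -exprM (prim_expr_order iP) subrr.
by rewrite mulf_eq0 subr_eq0 -(prim_order_dvd iP) /= addr_eq0.
Qed.

Lemma is_squareN3 (p : nat) : prime p -> p = 1 %[mod 3] -> is_square (-3 : 'F_p).
Proof.
move=> pp p1; have [g gP] := finField_prim_root 'F_p.
rewrite card_Fp // in gP; have p_gt1 := prime_gt1 pp.
have /(dvdn_prim_root gP) : (3 %| p.-1)%N by lia.
set w := g ^+ _ => /prim3_root_eq w0; apply/existsP; exists (2 * w + 1).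
have -> : (2 * w + 1) ^+ 2 = 4 * (w ^+ 2 + w + 1) - 3 by ring.
by rewrite w0 mulr0 add0r.
Qed.

Section GaussSum.

Variables (q : nat) (L : fieldType) (zeta : L).
Hypotheses (pq : prime q) (zetaP : q.-primitive_root zeta).

(** The quadratic character takes values in L because the sum will be studied in a finite field of
    characteristic p that contains a q-th root of unity. *)
Definition quad_char (a : 'F_q) : L :=
  if a == 0 then 0 else if is_square a then 1 else -1.
Local Notation chi := quad_char.

Definition add_char (a : 'F_q) : L := zeta ^+ (a : nat).
Local Notation e := add_char.

Definition gauss_sum : L := \sum_a chi a * e a.

Lemma quad_charM : {morph chi : a b / a * b}.
Proof.
move=> a b; rewrite /chi mulf_eq0.
have [|a_nz] := eqVneq a 0; first by rewrite mul0r.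
have [|b_nz] := eqVneq b 0; first by rewrite mulr0.
have [sqa|nsqa] := boolP (is_square a); first by rewrite is_squareMl // mul1r.
have [sqb|nsqb] := boolP (is_square b); last by rewrite is_squareM_non // mulrNN mulr1.
by rewrite mulrC is_squareMl // (negPf nsqa) mulr1.
Qed.

Lemma quad_char_sqr a : a != 0 -> chi a ^+ 2 = 1.
Proof. by rewrite /chi => /negPf->; case: ifP; rewrite ?sqrrN expr1n. Qed.

Lemma add_charD a b : e (a + b) = e a * e b.
Proof.
rewrite /e -exprD -(prim_expr_mod zetaP (a + b)%N) /=.
by rewrite [in X in (_ %% X)%N](Fp_cast pq).
Qed.

Lemma sum_add_char (t : 'F_q) : \sum_a e (a * t) = if t == 0 then q%:R else 0.
Proof.
have [->|t_nz] := eqVneq t 0.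
  rewrite (eq_bigr (fun=> 1)) => [|a _]; last by rewrite mulr0.
  by rewrite sumr_const cardE -cardT card_Fp.
have e1 : e 1 != 1.
  rewrite /e /= -(prim_order_dvd zetaP) modn_small // dvdn1.
  by rewrite neq_ltn prime_gt1 ?orbT.
(* Translating a by the inverse of t multiplies the sum by [e 1], which is not 1. *)
apply: (mulfI (_ : e 1 - 1 != 0)); first by rewrite subr_eq0.
rewrite mulr0 mulrBl mul1r mulr_sumr [X in X - _](reindex_onto (fun a => a - t^-1) (fun a => a + t^-1)) /=; last first.
  by move=> a _; rewrite addrK.
apply/eqP; rewrite subr_eq0; apply/eqP/eq_big => a; first by rewrite subrK eqxx.
by move=> _; rewrite -add_charD mulrBl mulVf // addrC subrK.
Qed.

Lemma sum_quad_char (n : 'F_q) : ~~ is_square n -> 2 != 0 :> L -> \sum_a chi a = 0.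
Proof.
move=> nsq two_nz; have n_nz : n != 0.
  by apply: contra nsq => /eqP->; apply/existsP; exists 0; rewrite expr0n.
have : \sum_a chi a = - \sum_a chi a.
  rewrite [LHS](reindex_onto (fun a => n * a) (fun a => n^-1 * a)) /=; last first.
    by move=> a _; rewrite mulVKf.
  rewrite -sumrN; apply: eq_big => a; first by rewrite mulKf ?eqxx.
  by move=> _; rewrite quad_charM {1}/chi (negPf n_nz) (negPf nsq) mulN1r.
move/eqP; rewrite -addr_eq0 -mulr2n -mulr_natl mulf_eq0 (negPf two_nz).
by move/eqP.
Qed.

(** In the double sum over a and b, put b = a c: the characters combine to chi(c) e(a (1 + c)).
    Summing over nonzero a gives q - 1 for c = -1 and -1 otherwise, and the sum of all chi(c) is
    zero. *)
Lemma gauss_sum_sqr (n : 'F_q) : ~~ is_square n -> 2 != 0 :> L ->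
  gauss_sum ^+ 2 = chi (-1) * q%:R.
Proof.
move=> nsq two_nz; have sum0 := sum_quad_char nsq two_nz.
have [chi0 e0] : chi 0 = 0 /\ e 0 = 1 by rewrite /chi eqxx.
transitivity (\sum_c \sum_a (if a == 0 then 0 else chi c * e (a * (1 + c)))).
  rewrite exchange_big expr2 {1}/gauss_sum mulr_suml; apply: eq_bigr => a _ /=.
  have [->|a_nz] := eqVneq a 0; first by rewrite chi0 !mul0r big1.
  rewrite mulr_sumr (reindex_onto (fun c => a * c) (fun c => a^-1 * c)) /=; last first.
    by move=> c _; rewrite mulVKf.
  apply: eq_big => c; first by rewrite mulKf ?eqxx.
  move=> _; rewrite quad_charM mulrDr mulr1 add_charD.
  by rewrite -[RHS]mul1r -(quad_char_sqr a_nz); ring.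
transitivity (\sum_c (chi c * (if 1 + c == 0 then q%:R else 0) - chi c)).
  apply: eq_bigr => c _; rewrite -sum_add_char (bigD1 0) //= ?eqxx add0r.
  rewrite [in RHS](bigD1 0) //= mul0r e0 mulrDr mulr1 [RHS]addrC addKr mulr_sumr.
  by apply: eq_bigr => a /negPf->.
rewrite sumrB sum0 subr0 (bigD1 (-1)) //= subrr eqxx big1 ?addr0 // => c c_ne.
by rewrite addrC addr_eq0 (negPf c_ne) mulr0.
Qed.

(** The p-th power is additive in characteristic p, fixes the values of chi as p is odd, and sends
    e(a) to e(p a); reindexing by p a extracts chi(p). *)
Lemma gauss_sum_Frobenius p : p \in [pchar L] -> odd p -> (p%:R : 'F_q) != 0 ->
  gauss_sum ^+ p = chi p%:R * gauss_sum.
Proof.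
move=> pL op p_nz; rewrite -(pFrobenius_autE pL) /gauss_sum rmorph_sum mulr_sumr.
rewrite [RHS](reindex_onto (fun a => p%:R * a) (fun a => p%:R^-1 * a)) /=; last first.
  by move=> a _; rewrite mulVKf.
apply: eq_big => a; first by rewrite mulKf ?eqxx.
move=> _; rewrite pFrobenius_autE exprMn quad_charM mulrA mulrA -expr2 quad_char_sqr // mul1r.
congr (_ * _).
  rewrite /chi; case: ifP => _; first by rewrite expr0n; case: (p) op.
  by case: ifP => _; rewrite ?expr1n // -signr_odd op expr1.
have en m : e (m%:R * a) = e a ^+ m.
  elim: m => [|m IHm]; first by rewrite mul0r.
  by rewrite -natr1 mulrDl mul1r add_charD IHm exprSr.
by rewrite en.
Qed.

End GaussSum.

(** If q were a square mod p, the Gauss sum G would lie in the prime field, so G^p = G; but G^p = -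
    G since p is a nonresidue mod q. Then G = 0, against G^2 = q or - q. *)
Lemma nonresidue_reciprocity (p q : nat) : prime p -> prime q -> odd p -> odd q ->
  p != q -> p = 1 %[mod 4] \/ q = 1 %[mod 4] ->
  ~~ is_square (p%:R : 'F_q) -> ~~ is_square (q%:R : 'F_p).
Proof.
move=> pp pq op oq pneq mod4 nsq; apply/negP => sq.
(* By Fermat q divides p^(q-1) - 1, so this field contains a primitive q-th root of unity. *)
have [|L pL cardL] := @pPrimePowerField p q.-1 pp.
  by rewrite -ltnS prednK ?prime_gt1 ?prime_gt0.
have [g gP] := finField_prim_root L; rewrite cardL in gP.
have qdvd : (q %| (p ^ q.-1).-1)%N.
  have cop : coprime p q by rewrite prime_coprime // dvdn_prime2.
  have := Euler_exp_totient cop; rewrite totient_prime // => /eqP.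
  by rewrite eqn_mod_dvd ?expn_gt0 ?prime_gt0 // subn1.
have zP := dvdn_prim_root gP qdvd; set z := g ^+ _ in zP.
have natL m : (m%:R == 0 :> L) = (p %| m)%N by rewrite -(dvdn_pcharf pL).
have two_nz : 2 != 0 :> L.
  by rewrite natL dvdn_prime2 //; apply: contraL op => /eqP->.
have q_nz : q%:R != 0 :> L by rewrite natL dvdn_prime2.
have p_nz : p%:R != 0 :> 'F_q.
  by rewrite -(dvdn_pcharf (pchar_Fp pq)) dvdn_prime2 // eq_sym.
have G2 := gauss_sum_sqr pq zP nsq two_nz.
have Gp := gauss_sum_Frobenius pq zP pL op p_nz.
set G := gauss_sum q z in G2 Gp.
have liftL (x : 'F_p) (d : int) : x ^+ 2 = d%:~R -> exists r : nat, r%:R ^+ 2 = d%:~R :> L.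
  move=> xd; exists (x : nat); apply/eqP; rewrite -subr_eq0.
  have := dvdz_Fp ((x : nat)%:Z ^+ 2 - d) pp; rewrite (dvdz_pcharf pL).
  by rewrite !rmorphB !rmorphXn /= -!pmulrn natr_Zp xd subrr eqxx => ->.
(* Either chi(-1) = 1, or q is not 1 mod 4; in the latter case p is, and - q is a square mod p. *)
have [r rE] : exists r : nat, G ^+ 2 = r%:R ^+ 2.
  have [sqN1|nsqN1] := boolP (is_square (-1 : 'F_q)).
    have [x /eqP xq] := existsP sq; have [r rE] := liftL x q xq.
    by exists r; rewrite G2 rE /quad_char oppr_eq0 oner_eq0 sqN1 mul1r.
  case: mod4 => [p1|q1]; last by rewrite is_squareN1 in nsqN1.
  have /existsP[x /eqP xq] := is_squareM (is_squareN1 pp p1) sq.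
  have [|r rE] := liftL x (- q%:Z); first by rewrite xq mulN1r rmorphN.
  by exists r; rewrite G2 rE /quad_char oppr_eq0 oner_eq0 (negPf nsqN1) mulN1r rmorphN.
have GpG : G ^+ p = G.
  move/eqP: rE; rewrite eqf_sqr => /orP[] /eqP->.
    by rewrite -(pFrobenius_autE pL) pFrobenius_aut_nat.
  by rewrite exprNn -signr_odd op expr1 mulN1r -(pFrobenius_autE pL) pFrobenius_aut_nat.
move: Gp; rewrite GpG /quad_char (negPf p_nz) (negPf nsq) mulN1r => /eqP.
rewrite -addr_eq0 -mulr2n -mulr_natl mulf_eq0 (negPf two_nz) /= => /eqP G0.
move: G2; rewrite G0 expr0n /quad_char oppr_eq0 oner_eq0 => /esym/eqP.
by rewrite mulf_eq0 (negPf q_nz) orbF; case: ifP; rewrite ?oppr_eq0 oner_eq0.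
Qed.

(** * Legendre's theorem by pigeonhole *)

Lemma floor_sqrt (n : nat) : exists m, (m ^ 2 <= n < m.+1 ^ 2)%N.
Proof.
elim: n => [|n [m /andP[le_m lt_m]]]; first by exists 0%N.
have [lt|le] := ltnP n.+1 (m.+1 ^ 2); first by exists m; rewrite lt (leqW le_m).
by exists m.+1; rewrite le /=; nia.
Qed.

Lemma prime_mul_nonsquare (r t m : nat) : prime r -> ~~ (r %| t)%N ->
  (m ^ 2)%N != (r * t)%N.
Proof.
move=> pr rNt; apply: contra rNt => /eqP mE.
have : (r %| m ^ 2)%N by rewrite mE dvdn_mulr.
rewrite Euclid_dvdX // andbT => /dvdnP[k kE].
rewrite -(@dvdn_pmul2l r) ?prime_gt0 // -mE kE; apply/dvdnP; exists (k ^ 2)%N; ring.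
Qed.

(** Both inequalities are strict: the upper one makes the pigeonhole boxes large enough, the lower
    one keeps squared differences strictly below r t. *)
Lemma floor_sqrt_lt (r t : nat) : prime r -> ~~ (r %| t)%N ->
  exists m, (m ^ 2 < r * t < m.+1 ^ 2)%N.
Proof.
move=> pr rNt; have [m /andP[le lt]] := floor_sqrt (r * t).
by exists m; rewrite lt andbT ltn_neqAle le prime_mul_nonsquare.
Qed.

Lemma pigeonhole (A B : finType) (f : A -> B) : (#|B| < #|A|)%N ->
  exists x y, x != y /\ f x = f y.
Proof.
move=> ltBA; have : ~~ injectiveb f.
  by apply/negP => /injectiveP /leq_card; rewrite leqNgt ltBA.
by case/injectivePn => x [y ne eq]; exists x, y.
Qed.

Lemma sqr_diff_leq (m : nat) (x y : 'I_m.+1) :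
  (x%:Z - y%:Z) ^+ 2 <= m%:Z ^+ 2.
Proof. by have := ltn_ord x; have := ltn_ord y; rewrite !ltnS; nia. Qed.

Lemma sqrz_ltM (m r t : nat) :
  (m ^ 2 < r * t)%N -> m%:Z ^+ 2 < r%:Z * t%:Z.
Proof. by rewrite -PoszM -rmorphXn ltz_nat. Qed.

(** Thue's argument: with c^2 = -1 mod q, two points of the box share the value of x - c y. Their
    differences satisfy 0 < a^2 + b^2 < 2 q, and q divides a^2 + b^2. *)
Lemma prime_sum_two_squares (q : nat) : prime q -> q = 1 %[mod 4] ->
  exists a b : int, a ^+ 2 + b ^+ 2 = q%:Z.
Proof.
move=> pq q1; have /existsP[c /eqP c2] := is_squareN1 pq q1.
have [m /andP[lt_mq lt_qm]] : exists m, (m ^ 2 < q < m.+1 ^ 2)%N.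
  have [|m] := @floor_sqrt_lt q 1 pq; last by rewrite muln1; exists m.
  by rewrite dvdn1 neq_ltn prime_gt1 ?orbT.
pose f (u : 'I_m.+1 * 'I_m.+1) : 'F_q := (u.1 : nat)%:R - c * (u.2 : nat)%:R.
have [|[x y] [[x' y'] [ne]]] := @pigeonhole _ _ f.
  by rewrite card_Fp // card_prod card_ord.
rewrite /f /= => eqf; pose a := x%:Z - x'%:Z; pose b := y%:Z - y'%:Z.
have dvd_ab : (q %| a ^+ 2 + b ^+ 2)%Z.
  rewrite dvdz_Fp // rmorphD !rmorphXn !rmorphB /= -!pmulrn.
  have -> : x%:R - x'%:R = c * (y%:R - y'%:R) :> 'F_q.
    apply/eqP; rewrite -subr_eq0; apply/eqP.
    transitivity (x%:R - c * y%:R - (x'%:R - c * y'%:R)); first by ring.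
    by rewrite eqf subrr.
  by rewrite exprMn c2 mulN1r addNr.
have /dvdzP[k kE] := dvd_ab.
have a2 : a ^+ 2 <= m%:Z ^+ 2 by exact: sqr_diff_leq.
have b2 : b ^+ 2 <= m%:Z ^+ 2 by exact: sqr_diff_leq.
have ab_gt0 : 0 < a ^+ 2 + b ^+ 2.
  rewrite lt_neqAle addr_ge0 ?sqr_ge0 // andbT eq_sym paddr_eq0 ?sqr_ge0 // !sqrf_eq0.
  apply: contra ne; rewrite !subr_eq0 !eqz_nat => /andP[/eqP xx /eqP yy].
  by apply/eqP; congr (_, _); apply: val_inj.
exists a, b; rewrite kE; suff -> : k = 1 by rewrite mul1r.
have q_gt0 : 0 < q%:Z by rewrite ltz_nat prime_gt0.
have k_gt0 : 0 < k by rewrite -(pmulr_lgt0 _ q_gt0) -kE.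
have k_lt2 : k < 2 by rewrite -(ltr_pM2r q_gt0) -kE; lia.
by lia.
Qed.

(* Legendre's theorem for Z^2 + 3 q X^2 = 3 p Y^2.  The congruences
   u = v mod 3, v = c w mod q, u = d w mod p make E = q u^2 + 3 w^2 - p v^2
   divisible by 3pq, and the box bounds force E = 0 or E = 3pq.  In the latter
   case (3w)^2 - 3p v^2 = -3q (u^2 - 3p), so multiplying by the norm u^2 - 3p of
   u + sqrt(3p) gives a zero. *)
Lemma legendre_ternary (p q : nat) (c : 'F_q) (d : 'F_p) :
  prime p -> prime q -> p != q -> p != 3 -> q != 3 -> p = q %[mod 3] ->
  p%:R * c ^+ 2 = 3 -> q%:R * d ^+ 2 = -3 ->
  exists X Y Z : int, [|| X != 0, Y != 0 | Z != 0] /\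
    Z ^+ 2 + 3 * q%:Z * X ^+ 2 - 3 * p%:Z * Y ^+ 2 = 0.
Proof.
move=> pp pq pneq p3 q3 pq3 cE dE.
have p3' : ~~ (3 %| p)%N by rewrite dvdn_prime2 // eq_sym.
have q3' : ~~ (3 %| q)%N by rewrite dvdn_prime2 // eq_sym.
have pq' : ~~ (p %| q)%N by rewrite dvdn_prime2.
have [m1 /andP[lt1 gt1]] := floor_sqrt_lt (isT : prime 3) p3'.
have [m2 /andP[lt2 gt2]] := floor_sqrt_lt (isT : prime 3) q3'.
have [m3 /andP[lt3 gt3]] := floor_sqrt_lt pp pq'.
pose f (t : 'I_m1.+1 * 'I_m2.+1 * 'I_m3.+1) : 'F_3 * 'F_q * 'F_p :=
  ((t.1.1 : nat)%:R - (t.1.2 : nat)%:R, (t.1.2 : nat)%:R - c * (t.2 : nat)%:R,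
   (t.1.1 : nat)%:R - d * (t.2 : nat)%:R).
have [|[[x y] z] [[[x' y'] z'] [ne]]] := @pigeonhole _ _ f.
  rewrite !card_prod !card_Fp // !card_ord.
  (* The squared side lengths exceed 3p, 3q and pq, whose product is (3pq)^2. *)
  have sq : ((3 * q * p) ^ 2 < (m1.+1 * m2.+1 * m3.+1) ^ 2)%N.
    have -> : ((3 * q * p) ^ 2 = (3 * p) * (3 * q) * (p * q))%N by ring.
    by rewrite !expnMn; do 2?[apply: ltn_mul => //].
  by rewrite -(ltn_exp2r _ _ (isT : 0 < 2)%N).
move=> eqf; have f1 := congr1 (fun t => t.1.1) eqf.
have f2 := congr1 (fun t => t.1.2) eqf; have {eqf} f3 := congr1 snd eqf.
rewrite /f /= in f1 f2 f3.
pose u := x%:Z - x'%:Z; pose v := y%:Z - y'%:Z; pose w := z%:Z - z'%:Z.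
have u2 : u ^+ 2 < 3 * p%:Z := le_lt_trans (sqr_diff_leq _ _) (sqrz_ltM lt1).
have v2 : v ^+ 2 < 3 * q%:Z := le_lt_trans (sqr_diff_leq _ _) (sqrz_ltM lt2).
have w2 : w ^+ 2 < p%:Z * q%:Z := le_lt_trans (sqr_diff_leq _ _) (sqrz_ltM lt3).
have nz : [|| u != 0, v != 0 | w != 0].
  apply: contraR ne; rewrite !negb_or !negbK !subr_eq0 !eqz_nat.
  move=> /and3P[/eqP xx /eqP yy /eqP zz].
  by apply/eqP; congr (_, _, _); apply: val_inj.
have move_diff (R : comNzRingType) (a1 a2 b1 b2 e : R) :
    a1 - e * b1 = a2 - e * b2 -> a1 - a2 = e * (b1 - b2).
  move=> ab; apply/eqP; rewrite -subr_eq0; apply/eqP.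
  transitivity (a1 - e * b1 - (a2 - e * b2)); first by ring.
  by rewrite ab subrr.
pose E := q%:Z * u ^+ 2 + 3 * w ^+ 2 - p%:Z * v ^+ 2.
have E3 : (3 %| E)%Z.
  have -> : E = (q%:Z - p%:Z) * u ^+ 2 + w ^+ 2 * 3 + p%:Z * (u ^+ 2 - v ^+ 2).
    by rewrite /E; ring.
  apply: rpredD; first apply: rpredD.
  - by apply: dvdz_mulr; rewrite -eqz_mod_dvd !modz_nat pq3.
  - exact: dvdz_mull.
  apply: dvdz_mull; rewrite (@dvdz_Fp 3) // rmorphB !rmorphXn !rmorphB /= -!pmulrn.
  suff -> : x%:R - x'%:R = y%:R - y'%:R :> 'F_3 by rewrite subrr.
  by rewrite -[RHS]mul1r; apply: move_diff; rewrite !mul1r.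
have Eq : (q %| E)%Z.
  rewrite dvdz_Fp // rmorphB rmorphD (rmorphM _ 3) !(rmorphM _ _%:Z).
  rewrite !rmorphXn !rmorphB /= -!pmulrn (move_diff _ _ _ _ _ _ f2) pchar_Fp_0 //.
  by rewrite mul0r add0r exprMn (mulrA p%:R) cE subrr.
have Ep : (p %| E)%Z.
  rewrite dvdz_Fp // rmorphB rmorphD (rmorphM _ 3) !(rmorphM _ _%:Z).
  rewrite !rmorphXn !rmorphB /= -!pmulrn (move_diff _ _ _ _ _ _ f3) pchar_Fp_0 //.
  by rewrite mul0r subr0 exprMn (mulrA q%:R) dE mulNr addNr.
have /dvdzP[k kE] : (3 * q%:Z * p%:Z %| E)%Z.
  have cop3q : coprimez 3 q by rewrite coprimezE prime_coprime.
  have cop3qp : coprimez (3 * q%:Z) p.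
    rewrite coprimezE abszM coprimeMl prime_coprime // p3' coprime_sym.
    by rewrite prime_coprime.
  by rewrite (Gauss_dvdz _ cop3qp) (Gauss_dvdz _ cop3q) E3 Eq.
have p_gt0 : 0 < p%:Z by rewrite ltz_nat prime_gt0.
have q_gt0 : 0 < q%:Z by rewrite ltz_nat prime_gt0.
have pq_gt0 : 0 < 3 * q%:Z * p%:Z by rewrite !mulr_gt0.
have [qu2 pv2] : q%:Z * u ^+ 2 < q%:Z * (3 * p%:Z) /\ p%:Z * v ^+ 2 < p%:Z * (3 * q%:Z).
  by rewrite !ltr_pM2l.
have [qu0 pv0] : 0 <= q%:Z * u ^+ 2 /\ 0 <= p%:Z * v ^+ 2.
  by split; apply: mulr_ge0; rewrite ?sqr_ge0 // ltW.
have w0 := sqr_ge0 w.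
(* Each of q u^2, 3 w^2 and p v^2 is below 3pq, so -3pq < E < 6pq. *)
have k_lt2 : k < 2 by rewrite -(ltr_pM2r pq_gt0) -kE /E; lra.
have k_gtN1 : -1 < k by rewrite -(ltr_pM2r pq_gt0) -kE /E; lra.
have [k0|k1] : k = 0 \/ k = 1 by lia.
  exists u, v, (3 * w); split; first by rewrite mulf_eq0 /=.
  have -> : (3 * w) ^+ 2 + 3 * q%:Z * u ^+ 2 - 3 * p%:Z * v ^+ 2 = 3 * E by rewrite /E; ring.
  by rewrite kE k0 mul0r mulr0.
exists (u ^+ 2 - 3 * p%:Z), (3 * w + v * u), (3 * w * u + v * (3 * p%:Z)).
split; first by rewrite subr_eq0 lt_eqF.
have -> : (3 * w * u + v * (3 * p%:Z)) ^+ 2 + 3 * q%:Z * (u ^+ 2 - 3 * p%:Z) ^+ 2 -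
    3 * p%:Z * (3 * w + v * u) ^+ 2 =
  3 * (u ^+ 2 - 3 * p%:Z) * (E - 3 * q%:Z * p%:Z) by rewrite /E; ring.
by rewrite kE k1 mul1r subrr mulr0.
Qed.

(** * Isotropy when -3 is a square neither mod p nor mod q *)

Lemma isotropic_inert (F : fieldExtType rat) (s : F) (p q : nat) :
  s ^+ 2 = -3 -> prime p -> prime q -> odd p -> odd q -> p != q ->
  q = 1 %[mod 4] ->
  ~~ is_square (p%:R : 'F_q) -> ~~ is_square (q%:R : 'F_p) ->
  legendre (-3) p <> 1 -> legendre (-3) q <> 1 ->
  ~ anisotropic (p%:R : F) q%:R.
Proof.
move=> s2 pp pq op oq pneq q1 nsqp nsqq legp legq an.
have q3 : q != 3 by apply/eqP => q3; rewrite q3 in q1.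
have s_nz : s != 0.
  by rewrite -sqrf_eq0 s2 oppr_eq0 -[3]/(3%:~R) rat_ext_intr_eq0.
have [a [b ab]] := prime_sum_two_squares pq q1.
have abF : a%:~R ^+ 2 + b%:~R ^+ 2 = q%:R :> F.
  by rewrite -!rmorphXn -rmorphD ab.
have b_nz : b%:~R != 0 :> F.
  rewrite rat_ext_intr_eq0; apply/eqP => b0; move: ab; rewrite b0 expr0n addr0 => aq.
  have : (`|a| ^ 2)%N != (q * 1)%N.
    by apply: prime_mul_nonsquare; rewrite // dvdn1 neq_ltn prime_gt1 ?orbT.
  by rewrite muln1 -abszX aq eqxx.
have [p3|p3] := eqVneq p 3.
  (* With p = 3 = - s^2 the norm at this point is s^2 (a^2 + b^2 - q) = 0. *)
  have [|_ _ /eqP + _] := an (s * a%:~R) b%:~R s 0; last by rewrite (negPf s_nz).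
  rewrite p3; have -> : 3%:R = - s ^+ 2 :> F by rewrite s2 opprK.
  by rewrite /nform -abF; ring.
have nonsquareN3 l : prime l -> l != 3 -> legendre (-3) l <> 1 ->
    ~~ is_square (-3 : 'F_l).
  move=> pl l3 legl; apply/negP => sq; apply: legl; apply/legendre1 => //.
  by rewrite rmorphN; split=> //; rewrite oppr_eq0 -(dvdn_pcharf (pchar_Fp pl)) dvdn_prime2.
(* Since -3 is a square modulo primes that are 1 mod 3, both p and q are 2 mod 3, which settles the
   local condition at 3. *)
have mod3 l : prime l -> l != 3 -> legendre (-3) l <> 1 -> l = 2 %[mod 3].
  move=> pl l3 legl; have nsq := nonsquareN3 l pl l3 legl.
  have : (l %% 3)%N != 1 by apply: contra nsq => /eqP l1; exact: is_squareN3.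
  have : (l %% 3)%N != 0 by rewrite -[_ == _]/(3 %| l)%N dvdn_prime2 // eq_sym.
  by have := ltn_pmod l (isT : (0 < 3)%N); case: (l %% 3)%N => [|[|[|]]].
have pq3 : p = q %[mod 3] by rewrite (mod3 p) // (mod3 q).
have quot (l m : nat) (t : 'F_l) : prime l -> prime m -> l != m ->
    is_square (m%:R * t) -> exists c : 'F_l, m%:R * c ^+ 2 = t.
  move=> pl pm lm /existsP[y /eqP yE]; exists (y / m%:R).
  have m_nz : m%:R != 0 :> 'F_l by rewrite -(dvdn_pcharf (pchar_Fp pl)) dvdn_prime2.
  by rewrite exprMn yE expr2; field.
have [c cE] : exists c : 'F_q, p%:R * c ^+ 2 = 3.
  apply: quot; rewrite // 1?eq_sym //.
  have -> : p%:R * 3 = -1 * (p%:R * -3) :> 'F_q by ring.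
  by apply: is_squareM; [exact: is_squareN1 | apply: is_squareM_non => //; exact: nonsquareN3].
have [d dE] : exists d : 'F_p, q%:R * d ^+ 2 = -3.
  by apply: quot => //; apply: is_squareM_non => //; exact: nonsquareN3.
have [X [Y [Z [nz XYZ]]]] := legendre_ternary pp pq pneq p3 q3 pq3 cE dE.
pose x : F := X%:~R; pose y : F := Y%:~R; pose z : F := Z%:~R.
have xyz : z ^+ 2 = s ^+ 2 * (q%:R * x ^+ 2 - p%:R * y ^+ 2).
  rewrite s2; apply/eqP; rewrite -subr_eq0; apply/eqP.
  transitivity ((Z ^+ 2 + 3 * q%:Z * X ^+ 2 - 3 * p%:Z * Y ^+ 2)%:~R : F).
    rewrite rmorphB rmorphD !(rmorphM _ (_ * _)) !(rmorphM _ 3) !rmorphXn /=.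
    rewrite -/x -/y -/z -!pmulrn; ring.
  by rewrite XYZ.
(* The first and third entries are the coordinates of (z + s x sqrt q)(a + sqrt q), of norm (- p s^2
   y^2)(- b^2) = p (s b y)^2. *)
have [|x0 /eqP x1 x2 _] :=
  an (z * a%:~R + q%:R * s * x) (s * b%:~R * y) (z + s * x * a%:~R) 0.
  have -> : nform p%:R q%:R (z * a%:~R + q%:R * s * x) (s * b%:~R * y)
      (z + s * x * a%:~R) 0 =
    (z ^+ 2 - q%:R * s ^+ 2 * x ^+ 2) * (a%:~R ^+ 2 - q%:R) -
      p%:R * (s * b%:~R * y) ^+ 2 by rewrite /nform; ring.
  by rewrite xyz -abF; ring.
have y0 : y = 0 by apply/eqP; move: x1; rewrite !mulf_eq0 (negPf s_nz) (negPf b_nz).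
(* Eliminating z between the first and third entries leaves - s b^2 x. *)
have x_0 : x = 0.
  have : a%:~R * (z + s * x * a%:~R) - (z * a%:~R + q%:R * s * x) = 0.
    by rewrite x0 x2 mulr0 subr0.
  have -> : a%:~R * (z + s * x * a%:~R) - (z * a%:~R + q%:R * s * x) =
    - (s * b%:~R ^+ 2 * x) by rewrite -abF; ring.
  move/eqP; rewrite oppr_eq0 !mulf_eq0 (negPf s_nz) !(negPf b_nz).
  by move/eqP.
have z0 : z = 0 by rewrite -x2 x_0; ring.
move: nz; rewrite -!(rat_ext_intr_eq0 F) -/x -/y -/z x_0 y0 z0.
by rewrite eqxx.
Qed.

Theorem proposition6p2
  (F : fieldExtType rat) (eps : F)
  (heps : 3.-primitive_root eps)
  (hF : <<1; eps>>%VS = fullv)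
  (alpha : int) (halpha0 : alpha != 0) (halpha : cubefree alpha)
  (halpha1 : alpha != 1)
  (K : fieldExtType F) (beta : K)
  (hbeta : beta ^+ 3 = alpha%:~R)
  (hK : <<1; beta>>%VS = fullv)
  (p q : nat) (hp : prime p) (hq : prime q) (hpo : odd p) (hqo : odd q)
  (hpq : p != q)
  (hleg : legendre p q = -1)
  (hmod : p = 1 %[mod 4] \/ q = 1 %[mod 4]) :
  division_ring (quat (p%:R : K) (q%:R : K)) <->
  (legendre (-3) p = 1 \/ legendre (-3) q = 1).
Proof.
have nsqp : ~~ is_square (p%:R : 'F_q).
  exact: (legendreN1 p hq).1 hleg.
have nsqq : ~~ is_square (q%:R : 'F_p) by exact: nonresidue_reciprocity.
have natK n : (n%:R : K) = (n%:R : F)%:A by rewrite -in_algE rmorph_nat.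
rewrite natK natK quat_divisionP.
(* From K to F anisotropy restricts; from F to K it extends by the cubic Springer argument. *)
have -> : anisotropic ((p%:R : F)%:A : K) (q%:R : F)%:A <-> anisotropic (p%:R : F) q%:R.
  split=> [an x0 x1 x2 x3 N0|].
    have [|e0 e1 e2 e3] := an x0%:A x1%:A x2%:A x3%:A.
      by rewrite -(nform_morph (in_alg K)) N0 rmorph0.
    by split; apply: (fmorph_inj (in_alg K)); rewrite /= ?e0 ?e1 ?e2 ?e3 scale0r.
  apply: (anisotropic_kummer (alpha := alpha%:~R) heps _ hK); rewrite hbeta.
  by rewrite -in_algE rmorph_int.
split=> [an|[leg|leg]]; last 2 first.
- by apply: anisotropicC; apply: anisotropic_split heps hF hp hpo nsqq leg.
- exact: anisotropic_split heps hF hq hqo nsqp leg.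
have s2 : (2 * eps + 1) ^+ 2 = -3.
  have -> : (2 * eps + 1) ^+ 2 = 4 * (eps ^+ 2 + eps + 1) - 3 by ring.
  by rewrite (prim3_root_eq heps) mulr0 add0r.
have [/eqP|legp] := boolP (legendre (-3) p == 1); first by left.
have [/eqP|legq] := boolP (legendre (-3) q == 1); first by right.
move/eqP: legp => legp; move/eqP: legq => legq.
case: hmod => [p1|q1]; last by case: (isotropic_inert s2 hp hq hpo hqo hpq q1 nsqp nsqq legp legq an).
rewrite eq_sym in hpq.
by case: (isotropic_inert s2 hq hp hqo hpo hpq p1 nsqq nsqp legq legp (anisotropicC an)).
Qed.
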